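(* Let $n\ge 1$ be a natural number, and let $0=G_{n+1:0}\le G_{n+1:1}\le\cdots\le G_{n+1:n+1}$ be the ordered spacings of $n$ independent random variables uniformly distributed on $[0,1]$, with the convention $G_{n+1:0}=0$ (as defined in the context). Then for every integer $k$ with $0\le k\le n+1$ $$\mathsf{E}\,G_{n+1:k}=\frac{H_{n+1}-H_{n+1-k}}{n+1},$$ where $H_j:=1+\frac12+\dots+\frac1j$ is the $j$th harmonic number for integers $j\ge1$, and $H_0:=0$.
   Context: Let $U_1,\dots,U_n$ be independent random variables, each uniformly distributed on $[0,1]$, and let $U_{n:1}\le\cdots\le U_{n:n}$ be the corresponding order statistics. Put $U_{n:0}:=0$ and $U_{n:n+1}:=1$. The gaps (spacings) are $G_i:=U_{n:i}-U_{n:i-1}$ for integers $i$ with $1\le i\le n+1$. Let $G_{n+1:1}\le\cdots\le G_{n+1:n+1}$ denote the values $G_1,\dots,G_{n+1}$ arranged in nondecreasing order (their order statistics, counted with multiplicity). Also put $G_{n+1:0}:=0$. $\mathsf{E}$ denotes expectation. *)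

(* Defs.v *)
From mathcomp Require Import all_boot all_order all_algebra.
From mathcomp Require Import all_classical all_reals all_analysis.

Set Implicit Arguments.
Unset Strict Implicit.
Unset Printing Implicit Defensive.

Import Order.TTheory GRing.Theory Num.Theory.
Import numFieldNormedType.Exports.

Local Open Scope classical_set_scope.
Local Open Scope ring_scope.

Definition mutually_independent d d' (T : measurableType d)
    (T' : measurableType d') (R : realType) (P : probability T R)
    (I : finType) (X : I -> {RV P >-> T'}) : Prop :=
  forall (J : {set I}) (B : I -> set T'),
    (forall i, i \in J -> measurable (B i)) ->
    P (\bigcap_(i in [set` J]) (X i @^-1` B i)) =
    (\prod_(i in J) P (X i @^-1` B i))%E.

(* Laws are compared on Borel sets only: [distribution] and [uniform_prob] are
   total functions on [set R], with no meaning on non-measurable sets. *)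
Definition uniform01 d (T : measurableType d) (R : realType)
    (P : probability T R) (X : {RV P >-> R}) : Prop :=
  forall A : set R, measurable A ->
    distribution P X A = uniform_prob (@ltr01 R) A.

(* x_{m:k}, the k-th smallest of x_1, ..., x_m counted with multiplicity.
   Ranks k start at 1; the value is meaningful for 1 <= k <= m. *)
Definition order_stat (R : realType) (m : nat) (x : 'I_m -> R) (k : nat) : R :=
  nth 0 (sort <=%R (codom x)) k.-1.

(* The order statistics of points of [0, 1] with the conventions
   u_{n:0} = 0 and u_{n:n+1} = 1. *)
Definition bordered_order_stat (R : realType) (n : nat) (u : 'I_n -> R)
    (i : nat) : R :=
  if i == 0%N then 0 else if i == n.+1 then 1 else order_stat u i.

(* Meaningful for 1 <= i <= n+1. *)
Definition gap (R : realType) (n : nat) (u : 'I_n -> R) (i : nat) : R :=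
  bordered_order_stat u i - bordered_order_stat u i.-1.

(* The shift reindexes the gaps 1, ..., n+1 by the ordinals 0, ..., n. *)
Definition ordered_gap (R : realType) (n : nat) (u : 'I_n -> R)
    (k : nat) : R :=
  if k == 0%N then 0 else order_stat (fun j : 'I_n.+1 => gap u j.+1) k.

Definition harmonic_number (R : realType) (j : nat) : R :=
  \sum_(1 <= i < j.+1) i%:R^-1.

(* Main.v *)
Require Import Defs.
From mathcomp Require Import all_boot all_order all_algebra.
From mathcomp Require Import all_classical all_reals all_analysis.
From mathcomp Require Import measurable_realfun fingroup perm.
From mathcomp Require Import zify ring lra.

Import Order.TTheory GRing.Theory Num.Theory.
Import numFieldNormedType.Exports.

Local Open Scope ring_scope.

(** Write [m = n + 1].  With [D_j := G_(m-j+1) - G_(m-j)] the claim is that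
    [E D_j = 1 / (m j)] for [1 <= j <= m]: summing these differences gives
    the harmonic expression.  The numbers [E D_j] are found from the linear
    system

      [sum_j 'C(j, s) * E D_j = 'C(m, s) / (s * m)],   [1 <= s <= m],

    which is triangular with unit diagonal, hence has one solution, and
    [1 / (m j)] solves it by the hockey-stick identity.  The left-hand side is
    the expected sum, over all sets of [s] gaps, of the smallest gap of the
    set: [D_j] is the length of the set of levels [t] exceeded by exactly [j]
    gaps, and such a level is counted by 'C(j, s) sets.

    The system itself is obtained as a limit of an exact count, so that no
    [n]-dimensional integral is computed.  Cut [0, 1] into [N = M + n] equal
    cells.  By independence each product of cells has probability [N ^- n].
    The products in which the [n] points lie in distinct cells correspond to
    pairs of a weak composition of [M] into [m] parts (the numbers of empty
    cells between consecutive points) and a permutation (the order of the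
    points).  They cover all but a vanishing proportion of the cube, and on
    each of them every ordered gap is within [3 / N] of the corresponding
    ordered part divided by [N], as order statistics are 1-Lipschitz for the
    sup norm ([order_stat_lipschitz]).  So the expectation of an ordered gap
    is the limit of averages over weak compositions
    ([cvg_total_ordered_part]).

    On the discrete side, the parts in a given set of [s] indices are all at
    least [t] in exactly 'C(M - s t + n, n) weak compositions (subtract [t]
    from these parts, [card_weak_compositions_ge]).  Summing over [t] and over
    the sets turns the left-hand side of the system into
    ['C(m, s) * sum_t 'C(M - s t + n, n)] ([total_ordered_part_bin]).  This sum
    takes one term out of [s] in a hockey-stick sum, so it is about
    ['C(N, m) / s], up to 'C(N, n) ([shifted_bin_sum_bounds]), and the right-hand
    side of the system appears in the limit ([cvg_shifted_bin_sum]). *)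

Set Implicit Arguments.
Unset Strict Implicit.

(** * Order statistics of a finite family *)

Section OrderStatistics.
Variable R : realType.

(** Counting is the form in which order statistics are used below: it gives at
    once their monotonicity, their measurability and, for integral data,
    their values. *)
Lemma order_stat_le (m : nat) (x : 'I_m -> R) (k : nat) (t : R) :
  (0 < k <= m)%N ->
  (order_stat x k <= t) = (k <= #|[pred i | (x i <= t)%R]|)%N.
Proof.
move=> /andP[k0 km].
have szs : size (sort <=%R (codom x)) = m.
  by rewrite size_sort size_codom card_ord.
have -> : #|[pred i | (x i <= t)%R]| = count (<= t) (sort <=%R (codom x)).
  by rewrite count_sort codomE count_map enumT cardE /enum_mem size_filter; exact: eq_count.
have srt : sorted <=%R (sort <=%R (codom x)) by apply: sort_le_sorted.
have km1 : (k.-1 < size (sort <=%R (codom x)))%N by rewrite szs prednK.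
rewrite -[in RHS](prednK k0) /order_stat.
apply/idP/idP => [xt|]; last exact: nth_count_le.
rewrite ltnNge; apply/negP => lek.
have := @nth_count_gt _ R t 0 (sort <=%R (codom x)) k.-1 srt.
by rewrite lek km1 => /(_ isT); rewrite ltNge xt.
Qed.

Lemma order_stat_codom (m : nat) (x : 'I_m -> R) (k : nat) :
  (0 < k <= m)%N -> exists i, order_stat x k = x i.
Proof.
move=> /andP[k0 km].
have : order_stat x k \in codom x.
  rewrite -(mem_sort <=%R) /order_stat mem_nth//.
  by rewrite size_sort size_codom card_ord prednK.
by move=> /codomP.
Qed.

(** The [k] smallest entries of [x] are at most [order_stat x k], so [y] has
    [k] entries that are at most [order_stat x k + e]. *)
Lemma order_stat_lipschitz_le (m : nat) (x y : 'I_m -> R) (k : nat) (e : R) :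
  (0 < k <= m)%N -> (forall i, y i <= x i + e) ->
  order_stat y k <= order_stat x k + e.
Proof.
move=> km xy; rewrite order_stat_le//.
have := lexx (order_stat x k); rewrite order_stat_le// => /leq_trans; apply.
apply: subset_leq_card; apply/fintype.subsetP => i; rewrite !inE => xi.
by rewrite (le_trans (xy i)) // lerD2r.
Qed.

Lemma order_stat_lipschitz (m : nat) (x y : 'I_m -> R) (k : nat) (e : R) :
  (0 < k <= m)%N -> (forall i, `|x i - y i| <= e) ->
  `|order_stat x k - order_stat y k| <= e.
Proof.
move=> km xy; rewrite ler_distl; apply/andP; split.
  rewrite lerBlDr; apply: order_stat_lipschitz_le => // i.
  by have := xy i; rewrite ler_distlC => /andP[].
apply: order_stat_lipschitz_le => // i.
by have := xy i; rewrite ler_distl => /andP[].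
Qed.

(** Up to the permutation [s], the family is already sorted. *)
Lemma order_stat_perm_increasing (n : nat) (a : 'I_n -> R) (s : {perm 'I_n}) (i : 'I_n) :
  (forall i j : 'I_n, (i <= j)%N -> a i <= a j) ->
  order_stat (a \o s) i.+1 = a i.
Proof.
move=> amono; rewrite /order_stat /=.
have -> : sort <=%R (codom (a \o s)) = codom a.
  rewrite -[RHS]sort_le_id.
    apply/perm_sort_leP.
    rewrite !codomE (map_comp a s).
    apply: perm_map; apply: uniq_perm.
    - by rewrite map_inj_uniq ?enum_uniq//; exact: perm_inj.
    - exact: enum_uniq.
    - move=> j; rewrite mem_enum; apply/mapP; exists (s^-1%g j); rewrite ?mem_enum//.
      by rewrite permKV.
  rewrite codomE; apply: (homo_sorted (e := fun i j : 'I_n => (i <= j)%N)) => //.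
  have := iota_sorted 0 n; rewrite -val_enum_ord sorted_map; exact.
by rewrite codomE (nth_map i) -?enumT ?size_enum_ord// nth_ord_enum.
Qed.
End OrderStatistics.

(** * Weak compositions with large parts *)

Section Compositions.
Local Open Scope nat_scope.

Definition weak_compositions (m M : nat) : {set m.-tuple 'I_M.+1} :=
  [set g : m.-tuple 'I_M.+1 | \sum_(i < m) tnth g i == M]%SET.

Lemma card_weak_compositions (n M : nat) :
  #|weak_compositions n.+1 M| = 'C(M + n, n).
Proof.
rewrite addnC -card_ord_partitions; apply: eq_card => g.
by rewrite !inE big_tuple.
Qed.

(** Subtracting [t] from the parts indexed by [S] is a bijection onto the weak
    compositions of [M - #|S| * t]. *)
Lemma card_weak_compositions_ge (n M t : nat) (S : {set 'I_n.+1}) :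
  #|[set g in weak_compositions n.+1 M | [forall i in S, t <= tnth g i]]%SET| =
  if #|S| * t <= M then 'C(M - #|S| * t + n, n) else 0.
Proof.
have sumS : \sum_(i < n.+1) t * (i \in S) = #|S| * t.
  rewrite -big_distrr /= mulnC -sum1_card [in RHS]big_mkcond.
  by congr (_ * _); apply: eq_bigr => i _; case: (i \in S).
case: leqP => [StM|MSt]; last first.
  apply/eqP; rewrite cards_eq0; apply/eqP/setP => g; rewrite !inE.
  apply/negbTE/negP => /andP[/eqP gM /forall_inP gS].
  have : #|S| * t <= M; last by rewrite leqNgt MSt.
  rewrite -sumS -gM; apply: leq_sum => i _.
  by case: (boolP (i \in S)) => iS; rewrite ?muln1 ?muln0// gS.
rewrite -card_weak_compositions.
set M' := M - #|S| * t.
have M'M : M' <= M by rewrite leq_subr.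
pose f (g : n.+1.-tuple 'I_M'.+1) : n.+1.-tuple 'I_M.+1 :=
  [tuple inord (tnth g i + t * (i \in S)) | i < n.+1].
have fE g i : g \in weak_compositions n.+1 M' -> tnth (f g) i = tnth g i + t * (i \in S) :> nat.
  move=> gM'; rewrite tnth_mktuple inordK// ltnS -(subnK StM).
  apply: leq_add; first by rewrite -ltnS.
  by case: (boolP (i \in S)) => iS; rewrite ?muln1 ?muln0// leq_pmull// (cardD1 i) iS.
rewrite -(card_in_imset (f := f)); last first.
  move=> g h gM hM fgh; apply: eq_from_tnth => i; apply: val_inj => /=.
  have := fE _ i gM; rewrite fgh fE// => /eqP.
  by rewrite eqn_add2r => /eqP.
apply: eq_card => g; apply/idP/imsetP.
  rewrite !inE => /andP[/eqP gM /forall_inP gS].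
  pose h : n.+1.-tuple 'I_M'.+1 := [tuple inord (tnth g i - t * (i \in S)) | i < n.+1].
  have gge i : t * (i \in S) <= tnth g i.
    by case: (boolP (i \in S)) => iS; rewrite ?muln1 ?muln0// gS.
  have sumh : \sum_(i < n.+1) (tnth g i - t * (i \in S)) = M'.
    by rewrite sumnB// gM sumS.
  have hE i : tnth h i = tnth g i - t * (i \in S) :> nat.
    rewrite tnth_mktuple inordK// ltnS -sumh (bigD1 i)//=; exact: leq_addr.
  have hM : h \in weak_compositions n.+1 M'.
    by rewrite inE; under eq_bigr do rewrite hE; rewrite sumh.
  exists h => //; apply: eq_from_tnth => i; apply: val_inj => /=.
  by rewrite fE// hE subnK.
move=> [h hM ->]; rewrite !inE; apply/andP; split.
  under eq_bigr do rewrite fE//.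
  move: (hM); rewrite big_split /= sumS inE => /eqP ->; apply/eqP; exact: subnK.
by apply/forall_inP => i iS; rewrite fE// iS muln1 leq_addl.
Qed.

Definition card_parts_ge {m M : nat} (g : m.-tuple 'I_M.+1) (t : nat) : nat :=
  #|[set i | t <= tnth g i]%SET|.

(** For [0 < s <= n.+1], the number of pairs of a level [t >= 1] and a weak
    composition of [M] into [n.+1] parts whose [s] first parts are all at
    least [t]. *)
Definition shifted_bin_sum (n s M : nat) : nat :=
  \sum_(1 <= t < M.+1) (if s * t <= M then 'C(M - s * t + n, n) else 0).

(** Both sides count the triples of a composition, a level [t] and a set of
    [s] parts that are all at least [t]. *)
Lemma sum_bin_card_parts_ge (n M s : nat) :
  \sum_(g in weak_compositions n.+1 M) \sum_(1 <= t < M.+1)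
    'C(card_parts_ge g t, s) = 'C(n.+1, s) * shifted_bin_sum n s M.
Proof.
rewrite exchange_big big_distrr; apply: eq_big_nat => t _ /=.
transitivity (\sum_(g in weak_compositions n.+1 M)
   \sum_(S : {set 'I_n.+1} | #|S| == s) [forall i in S, t <= tnth g i]).
  apply: eq_bigr => g _; rewrite -cards_draws -sum1_card.
  rewrite big_mkcond [RHS]big_mkcond; apply: eq_bigr => S _.
  rewrite inE andbC; case: eqP => //= _.
  have -> : (S \subset [set i | t <= tnth g i]%SET) = [forall i in S, t <= tnth g i].
    apply/idP/idP => [/fintype.subsetP h|/forallP h].
      by apply/forallP => i; apply/implyP => /h; rewrite inE.
    by apply/fintype.subsetP => i iS; rewrite inE; exact: implyP (h i) iS.
  by case: [forall i in S, t <= tnth g i].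
rewrite exchange_big /=.
transitivity (\sum_(S : {set 'I_n.+1} | #|S| == s)
   if s * t <= M then 'C(M - s * t + n, n) else 0).
  apply: eq_bigr => S /eqP Ss; rewrite -Ss -card_weak_compositions_ge.
  rewrite -sum1_card big_mkcond [RHS]big_mkcond; apply: eq_bigr => g _.
  by rewrite !inE; case: (_ == M) => //=; case: [forall i in S, t <= tnth g i].
rewrite sum_nat_const; congr (_ * _).
rewrite -[in RHS](card_ord n.+1) -card_draws; apply: eq_card => S.
by rewrite inE.
Qed.

(** Lowering all the levels by one uses up [s] units of the total. *)
Lemma shifted_bin_sum_rec (n s M : nat) : 0 < s ->
  shifted_bin_sum n s (M + s) = 'C(M + n, n) + shifted_bin_sum n s M.
Proof.
move=> s0; rewrite /shifted_bin_sum.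
rewrite big_ltn; last by lia.
rewrite muln1 leq_addl addnK; congr (_ + _).
rewrite big_add1 /= (big_cat_nat (n := M.+1))/=; [|lia|lia].
rewrite [X in _ + X]big_nat_cond [X in _ + X]big1 ?addn0; last first.
  move=> t /andP[/andP[Mt _] _]; case: ifP => //; nia.
by apply: eq_big_nat => t _; rewrite mulnS [M + s]addnC leq_add2l subnDl.
Qed.

Lemma shifted_bin_sum_small (n s M : nat) : M < s ->
  shifted_bin_sum n s M = 0.
Proof.
move=> Ms; rewrite /shifted_bin_sum big_nat_cond big1// => t /andP[/andP[t0 _] _].
by case: ifP => //; nia.
Qed.

(** The increment of 'C(_, n.+1) over [s] steps is a sum of [s] consecutive
    values of the nondecreasing function 'C(_, n). *)
Lemma bin_hockey_bounds (n s M : nat) :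
  'C(M + n, n.+1) + s * 'C(M + n, n) <= 'C(M + s + n, n.+1)
  <= 'C(M + n, n.+1) + s * 'C(M + s + n, n).
Proof.
elim: s => [|s /andP[IH1 IH2]]; first by rewrite !mul0n !addn0 leqnn.
rewrite addnS addSn binS.
have le1 : 'C(M + n, n) <= 'C(M + s + n, n) by apply: leq_bin2l; lia.
have le2 : 'C(M + s + n, n) <= 'C((M + s + n).+1, n) by apply: leq_bin2l; lia.
nia.
Qed.

(** By [shifted_bin_sum_rec], the sum retains one term out of [s] of the
    hockey-stick sum equal to 'C(M + n, n.+1), whose terms are monotone. *)
Lemma shifted_bin_sum_bounds (n s M : nat) : 0 < s ->
  s * shifted_bin_sum n s M <= 'C(M + n, n.+1)
  <= s * shifted_bin_sum n s M + s * 'C(M + n, n).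
Proof.
move=> s0; elim/ltn_ind: M => M IH.
have [Ms|sM] := ltnP M s.
  rewrite shifted_bin_sum_small// muln0 /= add0n.
  have /andP[_] := bin_hockey_bounds n M 0.
  rewrite !add0n (bin_small (ltnSn n)) => h; apply: leq_trans h _.
  by rewrite add0n leq_mul2r (ltnW Ms) orbT.
have /IH : M - s < M by lia.
rewrite -[in X in _ -> X](subnK sM); set L := M - s => /andP[h1 h2].
rewrite shifted_bin_sum_rec//.
have /andP[b1 b2] := bin_hockey_bounds n s L.
by rewrite mulnDr; apply/andP; split; lia.
Qed.
End Compositions.

(** * Ordered parts, asymptotics and the triangular system *)

Section OrderedParts.
Variable R : realType.

(** The [k]-th smallest part of [g], as the number of levels [t] that it
    reaches: this happens when more than [m - k] parts are at least [t].
    In this form the value at rank [0] is [0]. *)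
Definition ordered_part {m M : nat} (g : m.-tuple 'I_M.+1) (k : nat) : nat :=
  \sum_(1 <= t < M.+1) (m - k < card_parts_ge g t)%N.

Lemma order_stat_parts (m M : nat) (g : m.-tuple 'I_M.+1) (k : nat) :
  (0 < k <= m)%N ->
  order_stat (fun i => (tnth g i)%:R : R) k = (ordered_part g k)%:R.
Proof.
move=> km; have /andP[k0 kle] := km.
have [i xi] := @order_stat_codom R m (fun i => (tnth g i)%:R) k km.
rewrite xi; congr (_%:R).
(* The [k]-th part reaches [t] when fewer than [k] parts are at most [t.-1]. *)
have tE t : (0 < t)%N -> (m - k < card_parts_ge g t)%N = (t <= tnth g i)%N.
  move=> t0; have := @order_stat_le R m (fun i => (tnth g i)%:R) k (t.-1)%:R km.
  rewrite xi ler_nat => tE.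
  have -> : (t <= tnth g i)%N = ~~ (tnth g i <= t.-1)%N by lia.
  rewrite tE.
  set A := [pred i | _].
  have cA : (#|A| + card_parts_ge g t = m)%N.
    rewrite -[RHS]card_ord -(cardC A); congr (_ + _)%N.
    by apply: eq_card => j; rewrite !inE ler_nat; lia.
  lia.
rewrite /ordered_part; under eq_big_nat => t /andP[t0 _] do rewrite tE//.
have : (tnth g i <= M)%N by rewrite -ltnS.
move: (nat_of_ord (tnth g i)) => v vM.
rewrite (big_cat_nat (n := v.+1))//=.
rewrite (eq_big_nat _ _ (F2 := fun=> 1%N)); last first.
  by move=> t /andP[_ tv]; rewrite -ltnS tv.
rewrite sum_nat_const_nat muln1 subn1 /=.
rewrite big_nat_cond big1 ?addn0// => t /andP[/andP[vt _] _].
by rewrite leqNgt vt.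
Qed.

(** The difference of two consecutive ordered parts is the number of levels
    reached by exactly [j] parts, and each such level has weight 'C(j, s). *)
Lemma ordered_part_bin (m M s : nat) (g : m.-tuple 'I_M.+1) : (0 < s)%N ->
  \sum_(1 <= j < m.+1) 'C(j, s)%:R *
    ((ordered_part g (m - j).+1)%:R - (ordered_part g (m - j))%:R) =
  (\sum_(1 <= t < M.+1) 'C(card_parts_ge g t, s))%:R :> R.
Proof.
move=> s0; rewrite natr_sum.
transitivity (\sum_(1 <= j < m.+1) \sum_(1 <= t < M.+1)
    'C(j, s)%:R * (card_parts_ge g t == j)%:R : R).
  apply: eq_big_nat => j /andP[j0 jm].
  rewrite -big_distrr /=; congr (_ * _).
  rewrite /ordered_part !natr_sum -sumrB; apply: eq_bigr => t _.
  rewrite !subnS subKn//.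
  case: (ltngtP (card_parts_ge g t) j) => cj.
  - by rewrite (_ : (j.-1 < _)%N = false) ?subrr//; lia.
  - by rewrite (_ : (j.-1 < _)%N = true) ?subrr//; lia.
  - by rewrite cj (_ : (j.-1 < _)%N = true) ?subr0//; lia.
rewrite exchange_big /=; apply: eq_bigr => t _.
have cm : (card_parts_ge g t <= m)%N.
  by rewrite -[leqRHS]card_ord; exact: max_card.
case: (posnP (card_parts_ge g t)) => [c0|c0].
  rewrite c0 bin0n (gtn_eqF s0) big_nat_cond big1// => j /andP[/andP[j0 _] _].
  by rewrite (ltn_eqF j0) mulr0.
rewrite (bigD1_seq (card_parts_ge g t)) ?iota_uniq//=; last first.
  by rewrite mem_index_iota c0.
rewrite eqxx mulr1 big1 ?addr0// => j jc.
by rewrite eq_sym (negbTE jc) mulr0.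
Qed.

Definition total_ordered_part (n M k : nat) : nat :=
  \sum_(g in weak_compositions n.+1 M) ordered_part g k.

Lemma total_ordered_part_bin (n M s : nat) : (0 < s)%N ->
  \sum_(1 <= j < n.+2) 'C(j, s)%:R *
    ((total_ordered_part n M (n.+1 - j).+1)%:R
     - (total_ordered_part n M (n.+1 - j))%:R) =
  ('C(n.+1, s) * shifted_bin_sum n s M)%:R :> R.
Proof.
move=> s0; rewrite -sum_bin_card_parts_ge natr_sum.
transitivity (\sum_(g in weak_compositions n.+1 M) \sum_(1 <= j < n.+2) 'C(j, s)%:R *
    ((ordered_part g (n.+1 - j).+1)%:R - (ordered_part g (n.+1 - j))%:R) : R).
  rewrite exchange_big /=; apply: eq_bigr => j _.
  by rewrite -big_distrr /= sumrB !natr_sum.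
by apply: eq_bigr => g _; rewrite ordered_part_bin.
Qed.

End OrderedParts.

Section Limits.
Variable R : realType.
Local Open Scope classical_set_scope.

Lemma cvg_inv_shift (n : nat) : ((M + n)%:R : R)^-1 @[M --> \oo] --> (0 : R).
Proof.
rewrite (cvg_shiftn n (fun N : nat => (N%:R : R)^-1)).
rewrite -(cvg_shiftS (fun N : nat => (N%:R : R)^-1)).
exact: cvg_harmonic.
Qed.

(** The proportion of [k]-tuples of cells without repetition tends to [1], by
    induction on [k]: the next factor is [1 - k / (M + n)]. *)
Lemma cvg_ffact_ratio (n k : nat) : (0 < n)%N ->
  (((M + n) ^_ k)%:R / ((M + n)%:R ^+ k) : R) @[M --> \oo] --> (1 : R).
Proof.
move=> n0; elim: k => [|k IH].
  under eq_fun do rewrite ffactn0 expr0 divr1.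
  exact: cvg_cst.
have H : (1 - k%:R * ((M + n)%:R)^-1 : R) @[M --> \oo] --> (1 - k%:R * 0 : R).
  apply: cvgB; first exact: cvg_cst.
  by apply: cvgMr; exact: cvg_inv_shift.
rewrite -[X in _ --> X](_ : 1 * (1 - k%:R * 0) = 1 :> R); last by rewrite mulr0 subr0 mulr1.
apply: (cvg_trans _ (cvgM IH H)); apply: near_eq_cvg.
near=> M.
have kM : (k <= M)%N by near: M; exact: nbhs_infty_ge.
rewrite /= ffactnSr natrM natrB ?(leq_trans kM) ?leq_addr// exprS.
have N0 : (M + n)%:R != 0 :> R by rewrite pnatr_eq0; lia.
(* [field] would split the cast of the sum. *)
move: ((M + n)%:R : R) N0 => N N0.
by field; rewrite expf_neq0 ?N0.
Unshelve. all: by end_near. Qed.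

Lemma cvg_shifted_bin_sum (n s : nat) : (0 < n)%N -> (0 < s)%N ->
  (n`!%:R / (M + n)%:R ^+ n.+1 * (shifted_bin_sum n s M)%:R : R) @[M --> \oo]
  --> ((s * n.+1)%:R^-1 : R).
Proof.
move=> n0 s0.
have fac0 j : j`!%:R != 0 :> R by rewrite pnatr_eq0 -lt0n fact_gt0.
have s0' : s%:R != 0 :> R by rewrite pnatr_eq0 -lt0n.
have n1 : n.+1%:R != 0 :> R by rewrite pnatr_eq0.
have N0 M : (M + n)%:R != 0 :> R by rewrite pnatr_eq0; lia.
(* The bounds of [shifted_bin_sum_bounds], divided by [s] and normalized. *)
pose u M : R := ((M + n) ^_ n.+1)%:R / (M + n)%:R ^+ n.+1 * (s * n.+1)%:R^-1.
pose v M : R := u M - ((M + n) ^_ n)%:R / (M + n)%:R ^+ n * (M + n)%:R^-1.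
have cu : u M @[M --> \oo] --> ((s * n.+1)%:R^-1 : R).
  rewrite -[X in _ --> X]mul1r; apply: cvgM; last exact: cvg_cst.
  exact: cvg_ffact_ratio.
have cv : v M @[M --> \oo] --> ((s * n.+1)%:R^-1 : R).
  rewrite -[X in _ --> X]subr0 -(mulr0 1); apply: cvgB => //.
  by apply: cvgM; [exact: cvg_ffact_ratio|exact: cvg_inv_shift].
apply: (squeeze_cvgr _ cv cu); near=> M.
have bE k : ('C(M + n, k))%:R = ((M + n) ^_ k)%:R / k`!%:R :> R.
  by rewrite -bin_ffact natrM mulfK.
have w0 : 0 <= n`!%:R / (M + n)%:R ^+ n.+1 / s%:R :> R.
  by rewrite !divr_ge0 ?exprn_ge0.
have /andP[] := @shifted_bin_sum_bounds n s M s0.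
rewrite -!(ler_nat R) natrD !natrM !bE => h1 h2.
have uE : u M = n`!%:R / (M + n)%:R ^+ n.+1 / s%:R * (((M + n) ^_ n.+1)%:R / (n.+1)`!%:R).
  rewrite /u factS !natrM; move: (N0 M) n1 (fac0 n) (s0').
  move: ((M + n)%:R : R) (n.+1%:R : R) (n`!%:R : R) (s%:R : R) => N m f r N' m' f' r'.
  by field; rewrite ?m' ?f' ?r' ?expf_neq0.
apply/andP; split; last first.
  rewrite uE; apply: le_trans (ler_wpM2l w0 h1).
  by rewrite [leRHS]mulrA divfK.
rewrite /v uE lerBlDr; apply: le_trans (ler_wpM2l w0 h2) _.
rewrite le_eqVlt; apply/orP; left; apply/eqP; rewrite exprS.
move: (N0 M) (fac0 n) (fac0 n.+1) s0'.
move: ((M + n)%:R : R) (n`!%:R : R) ((n.+1)`!%:R : R) (s%:R : R) => N f f1 r N' f' f1' r'.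
by field; rewrite ?N' ?f' ?f1' ?r' ?expf_neq0.
Unshelve. all: by end_near. Qed.

End Limits.

Section Harmonic.
Variable R : realType.

(** The matrix of the system is triangular with unit diagonal; the unknowns
    are eliminated from the largest index downwards. *)
Lemma bin_triangular_unique (m : nat) (x y : nat -> R) :
  (forall s, (0 < s <= m)%N ->
    \sum_(1 <= j < m.+1) 'C(j, s)%:R * x j = \sum_(1 <= j < m.+1) 'C(j, s)%:R * y j) ->
  forall j, (0 < j <= m)%N -> x j = y j.
Proof.
move=> h j /andP[j0 jm]; move: j0.
have [l ->] : exists l, j = (m - l)%N by exists (m - j)%N; rewrite subKn.
elim/ltn_ind: l {j jm} => l IH l0.
have := h (m - l)%N; rewrite l0 leq_subr => /(_ isT).
have lm : (m - l < m.+1)%N by rewrite ltnS leq_subr.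
have split_sum z : \sum_(1 <= j < m.+1) 'C(j, m - l)%:R * z j =
    z (m - l)%N + \sum_((m - l).+1 <= j < m.+1) 'C(j, m - l)%:R * z j :> R.
  rewrite (big_cat_nat (n := m - l)) ?(ltnW lm)//=.
  rewrite big_nat_cond big1 ?add0r; last first.
    by move=> i /andP[/andP[_ il] _]; rewrite bin_small ?mul0r.
  by rewrite big_ltn// binn mul1r.
rewrite !split_sum.
rewrite [X in _ + X = _](_ : _ = \sum_((m - l).+1 <= i < m.+1) 'C(i, m - l)%:R * y i).
  by move=> /addIr.
apply: eq_big_nat => i /andP[li im]; congr (_ * _).
have -> : i = (m - (m - i))%N by lia.
by apply: IH; lia.
Qed.

(** The absorption identity [j * 'C(j.-1, s.-1) = s * 'C(j, s)] reduces the
    sum to a hockey-stick sum. *)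
Lemma sum_bin_inv (m s : nat) : (0 < s)%N ->
  \sum_(1 <= j < m.+1) 'C(j, s)%:R * ((m * j)%:R^-1 : R) = 'C(m, s)%:R / (s * m)%:R.
Proof.
move=> s0; have s0' : s%:R != 0 :> R by rewrite pnatr_eq0 -lt0n.
have [->|m0] := posnP m; first by rewrite big_geq// muln0 invr0 mulr0.
have m0' : m%:R != 0 :> R by rewrite pnatr_eq0 -lt0n.
transitivity ((\sum_(1 <= j < m.+1) 'C(j.-1, s.-1))%:R / (s * m)%:R : R).
  rewrite natr_sum big_distrl /=; apply: eq_big_nat => j /andP[j0 _].
  have j0' : j%:R != 0 :> R by rewrite pnatr_eq0 -lt0n.
  have := mul_bin_diag j s.-1; rewrite !prednK// => /(congr1 (fun n => n%:R : R)).
  rewrite !natrM => e.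
  have -> : ('C(j.-1, s.-1))%:R = s%:R * 'C(j, s)%:R / j%:R :> R.
    by rewrite -e; field.
  by field; rewrite m0' s0' j0'.
congr (_%:R / _); rewrite big_add1 /=.
elim: m {m0 m0'} => [|m IH]; first by rewrite big_geq// bin0n (gtn_eqF s0).
rewrite big_nat_recr//= IH; case: s s0 {s0' IH} => // s _ /=.
Qed.

Lemma harmonic_telescope (m : nat) (x : nat -> R) : x 0%N = 0 ->
  (forall j, (0 < j <= m)%N -> x (m - j).+1 - x (m - j)%N = (m * j)%:R^-1) ->
  forall k, (k <= m)%N ->
    x k = (harmonic_number R m - harmonic_number R (m - k)) / m%:R.
Proof.
move=> x0 dx; elim=> [|k IH] km; first by rewrite subn0 subrr mul0r.
have /dx : (0 < m - k <= m)%N by lia.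
rewrite subKn; last exact: ltnW.
move=> /eqP; rewrite subr_eq => /eqP ->; rewrite IH; last exact: ltnW.
have -> : (m - k = (m - k.+1).+1)%N by lia.
rewrite /harmonic_number [\sum_(1 <= i < (m - k.+1).+2) _]big_nat_recr//= natrM.
have m0 : m%:R != 0 :> R by rewrite pnatr_eq0; lia.
have m1 : (m - k.+1).+1%:R != 0 :> R by rewrite pnatr_eq0.
move: ((m - k.+1).+1%:R : R) m1 => r r0.
by field; rewrite m0 r0.
Qed.
End Harmonic.

(** * Gaps of lattice configurations *)

Section GapsDeterministic.
Variable R : realType.

Lemma bordered_order_stat_lipschitz (n : nat) (u v : 'I_n -> R) (e : R) (i : nat) :
  0 <= e -> (i <= n.+1)%N -> (forall j, `|u j - v j| <= e) ->
  `|bordered_order_stat u i - bordered_order_stat v i| <= e.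
Proof.
move=> e0 le_i uv; rewrite /bordered_order_stat.
case: eqP => [_|/eqP i0]; first by rewrite subrr normr0.
case: eqP => [_|/eqP in1]; first by rewrite subrr normr0.
by apply: order_stat_lipschitz => //; lia.
Qed.

(** A gap is a difference of two order statistics, hence the factor [2]. *)
Lemma ordered_gap_lipschitz (n : nat) (u v : 'I_n -> R) (e : R) (k : nat) :
  0 <= e -> (k <= n.+1)%N -> (forall j, `|u j - v j| <= e) ->
  `|ordered_gap u k - ordered_gap v k| <= 2 * e.
Proof.
move=> e0 kn uv; rewrite /ordered_gap.
case: eqP => [_|/eqP k0]; first by rewrite subrr normr0 mulr_ge0.
apply: order_stat_lipschitz => [|i]; first by rewrite lt0n k0.
rewrite /gap [X in `|X|](_ : _ =
    (bordered_order_stat u i.+1 - bordered_order_stat v i.+1)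
  - (bordered_order_stat u i - bordered_order_stat v i)); last by rewrite /=; ring.
apply: le_trans (ler_normB _ _) _; rewrite (_ : 2 * e = e + e); last by ring.
apply: lerD; apply: bordered_order_stat_lipschitz => //.
by rewrite ltnW.
Qed.

Lemma normr_ordered_gap_le1 (n : nat) (u : 'I_n -> R) (k : nat) :
  (k <= n.+1)%N -> (forall j, 0 <= u j <= 1) -> `|ordered_gap u k| <= 1.
Proof.
move=> kn u01; rewrite /ordered_gap; case: eqP => [_|/eqP k0].
  by rewrite normr0.
have [|i ->] := @order_stat_codom R n.+1 (fun j => gap u j.+1) k.
  by rewrite lt0n k0.
have b01 j : (j <= n.+1)%N -> 0 <= bordered_order_stat u j <= 1.
  move=> jn; rewrite /bordered_order_stat.
  case: eqP => [_|/eqP j0]; first by rewrite lexx ler01.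
  case: eqP => [_|/eqP jn1]; first by rewrite lexx ler01.
  have [|l ->] := @order_stat_codom R n u j; first by lia.
  exact: u01.
have /andP[a0 a1] := b01 i (ltnW (ltn_ord i)).
have /andP[b0 b1] := b01 i.+1 (ltn_ord i).
by rewrite /gap /= ler_norml; lra.
Qed.

(** Both sides satisfy the same inequalities [_ <= t], by [order_stat_le]. *)
Lemma order_stat_scale (m : nat) (c : R) (x : 'I_m -> R) (k : nat) :
  0 < c -> (0 < k <= m)%N ->
  order_stat (fun i => x i * c) k = order_stat x k * c.
Proof.
move=> c0 km.
have le_scale t : (order_stat (fun i => x i * c) k <= t) = (order_stat x k * c <= t).
  rewrite -ler_pdivlMr// !order_stat_le//; congr (_ <= _)%N.
  by apply: eq_card => i; rewrite !inE ler_pdivlMr.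
by apply: le_anti; rewrite le_scale lexx -le_scale lexx.
Qed.

Lemma order_stat_ext (m : nat) (x y : 'I_m -> R) (k : nat) :
  x =1 y -> order_stat x k = order_stat y k.
Proof. by move=> xy; rewrite /order_stat (eq_codom xy). Qed.

(** The cell, numbered from [0], that contains the point of rank [i] (also
    from [0]) when the parts of [g] are the numbers of empty cells around
    consecutive occupied cells. *)
Definition occupied_cell {m M : nat} (g : m.-tuple 'I_M.+1) (i : nat) : nat :=
  (\sum_(j < m | (j <= i)%N) tnth g j + i)%N.

Lemma occupied_cell_mono (m M : nat) (g : m.-tuple 'I_M.+1) (i j : nat) :
  (i < j)%N -> (occupied_cell g i < occupied_cell g j)%N.
Proof.
move=> ij; rewrite /occupied_cell -addnS leq_add//.
rewrite big_mkcond [leqRHS]big_mkcond leq_sum// => l _.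
by case: (leqP l i) => // li; rewrite (leq_trans li (ltnW ij)).
Qed.

Lemma occupied_cellS (n M : nat) (g : n.+1.-tuple 'I_M.+1) (i : 'I_n.+1) :
  (0 < i)%N -> occupied_cell g i = (occupied_cell g i.-1 + tnth g i + 1)%N.
Proof.
move=> i0; rewrite /occupied_cell (bigD1 i)//= addnC -addnA addn1.
rewrite -{1}(prednK i0).
rewrite (eq_bigl (fun j : 'I_n.+1 => (j <= i.-1)%N)); first by lia.
by move=> j; rewrite -val_eqE /=; lia.
Qed.

Lemma occupied_cell0 (n M : nat) (g : n.+1.-tuple 'I_M.+1) :
  occupied_cell g 0 = tnth g ord0.
Proof.
rewrite /occupied_cell addn0 (bigD1 ord0)//= big1 ?addn0// => j.
by rewrite -val_eqE /=; lia.
Qed.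

(** The index [n] is that of the conventional right end point of the unit
    interval, which would occupy the cell following the last one. *)
Lemma occupied_cell_last (n M : nat) (g : n.+1.-tuple 'I_M.+1) :
  g \in weak_compositions n.+1 M -> occupied_cell g n = (M + n)%N.
Proof.
rewrite inE => /eqP gM; rewrite /occupied_cell -[in RHS]gM; congr (_ + _)%N.
by apply: eq_bigl => j; rewrite -ltnS ltn_ord.
Qed.

(** The right end point is common to both families, so that all the
    successive differences, and hence all the parts, agree. *)
Lemma occupied_cell_inj (n M : nat) (g h : n.+1.-tuple 'I_M.+1) :
  g \in weak_compositions n.+1 M -> h \in weak_compositions n.+1 M ->
  (forall i : 'I_n, occupied_cell g i = occupied_cell h i) -> g = h.
Proof.
move=> gM hM gh.
have pE (i : 'I_n.+1) : occupied_cell g i = occupied_cell h i.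
  have := ltn_ord i; rewrite ltnS leq_eqVlt => /predU1P[->|ilt].
    by rewrite !occupied_cell_last.
  exact: (gh (Ordinal ilt)).
apply: eq_from_tnth => i; apply: val_inj => /=.
have [i0|i0] := posnP i.
  have -> : i = ord0 by apply: val_inj.
  by rewrite -!occupied_cell0; exact: (pE ord0).
have := pE i; rewrite !occupied_cellS//.
have ip : (i.-1 < n.+1)%N by have := ltn_ord i; lia.
have := pE (Ordinal ip) => /= ->; lia.
Qed.

Definition lattice_point {m M n : nat} (g : m.-tuple 'I_M.+1)
    (s : {perm 'I_n}) (i : 'I_n) : R :=
  (occupied_cell g (s i))%:R / (M + n)%:R.

Lemma order_stat_lattice_point (m M n : nat) (g : m.-tuple 'I_M.+1)
    (s : {perm 'I_n}) (i : 'I_n) :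
  order_stat (lattice_point g s) i.+1 = (occupied_cell g i)%:R / (M + n)%:R.
Proof.
rewrite -(@order_stat_perm_increasing R n (fun j : 'I_n => (occupied_cell g j)%:R / (M + n)%:R) s)//.
move=> {}i j ij; rewrite ler_pM2r; last by rewrite invr_gt0 ltr0n; have := ltn_ord i; lia.
rewrite ler_nat; move: ij; rewrite leq_eqVlt => /predU1P[->//|/occupied_cell_mono].
by move=> /(_ _ _ g)/ltnW.
Qed.

(** The points are the left ends of their cells, so that each gap except the
    first one also contains the cell of the preceding point. *)
Lemma gap_lattice_point (n M : nat) (g : n.+1.-tuple 'I_M.+1)
    (s : {perm 'I_n}) (i : 'I_n.+1) : (0 < n)%N ->
  g \in weak_compositions n.+1 M ->
  gap (lattice_point g s) i.+1 = (tnth g i + (0 < i))%:R / (M + n)%:R.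
Proof.
move=> n0 gM.
have N0 : (M + n)%:R != 0 :> R by rewrite pnatr_eq0; lia.
have bE (j : nat) : (j < n.+1)%N ->
    bordered_order_stat (lattice_point g s) j.+1 = (occupied_cell g j)%:R / (M + n)%:R.
  move=> jn; rewrite /bordered_order_stat /= eqSS; case: eqP => [->|/eqP jn'].
    by rewrite occupied_cell_last// divff.
  have jn2 : (j < n)%N by lia.
  exact: (order_stat_lattice_point g s (Ordinal jn2)).
rewrite /gap /= bE//; have [i0|i0] := posnP i.
  rewrite i0 /bordered_order_stat /= subr0 addn0 occupied_cell0.
  by congr (_%:R / _); congr (nat_of_ord (tnth _ _)); apply: val_inj.
rewrite -[X in _ - bordered_order_stat _ X](prednK i0) bE; last by have := ltn_ord i; lia.
by rewrite -mulrBl occupied_cellS// -addnA natrD addrAC subrr add0r.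
Qed.

Lemma ordered_gap_lattice_point (n M : nat) (g : n.+1.-tuple 'I_M.+1)
    (s : {perm 'I_n}) (k : nat) : (0 < n)%N -> (k <= n.+1)%N ->
  g \in weak_compositions n.+1 M ->
  `|ordered_gap (lattice_point g s) k - (ordered_part g k)%:R / (M + n)%:R|
  <= (M + n)%:R^-1.
Proof.
move=> n0 kn gM; rewrite /ordered_gap.
have N0 : 0 < (M + n)%:R :> R by rewrite ltr0n; lia.
case: eqP => [->|/eqP k0].
  rewrite /ordered_part subn0 big1 ?mul0r ?subrr ?normr0 ?invr_ge0 ?ltW// => t _.
  apply/eqP; rewrite eqb0 -leqNgt.
  by rewrite -[leqRHS](card_ord n.+1); exact: max_card.
have km : (0 < k <= n.+1)%N by rewrite lt0n k0.
rewrite -order_stat_parts// -order_stat_scale ?invr_gt0//.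
apply: order_stat_lipschitz => // i.
rewrite gap_lattice_point// -mulrBl natrD [X in X - _]addrC addrK.
rewrite normrM normr_nat normfV normr_nat.
by apply: ler_piMl; rewrite ?invr_ge0 ?ler0n// lern1 leq_b1.
Qed.

End GapsDeterministic.

Section Measurability.
Local Open Scope classical_set_scope.
Context (R : realType) (d : measure_display) (T : measurableType d).

(** By [order_stat_le], the event [order_stat x k <= t] is a finite union,
    over the sets of at least [k] indices, of finite intersections of events
    [x i <= t]. *)
Lemma measurable_order_stat (m : nat) (X : 'I_m -> T -> R) (k : nat) :
  (0 < k <= m)%N -> (forall i, measurable_fun setT (X i)) ->
  measurable_fun setT (fun w => order_stat (fun i => X i w) k).
Proof.
move=> km mX; apply: (measurability _ (measurable_realfun.RGenOInfty.measurableE R)).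
move=> /= _ [_ [t ->] <-]; rewrite setTI.
rewrite [X in measurable X](_ : _ = ~` \bigcup_(S in [set S : {set 'I_m} | (k <= #|S|)%N])
    \bigcap_(i in [set` S]) X i @^-1` `]-oo, t]); last first.
  apply/seteqP; split => w /=; rewrite in_itv /= andbT.
    move=> tw [S /= kS hS]; move: tw; rewrite ltNge => /negP; apply.
    rewrite order_stat_le// (leq_trans kS)//; apply: subset_leq_card.
    by apply/fintype.subsetP => i iS; have := hS i iS; rewrite inE /= in_itv.
  move=> h; rewrite ltNge; apply/negP; rewrite order_stat_le// => kS; apply: h.
  exists [set i | X i w <= t]%SET => /=; first by rewrite cardsE.
  by move=> i /=; rewrite inE in_itv.
apply: measurableC; apply: fin_bigcup_measurable => [|S _]; first exact: finite_finset.
apply: fin_bigcap_measurable => [|i _]; first exact: finite_finset.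
by rewrite -[X in measurable X]setTI; apply: mX.
Qed.

Lemma measurable_ordered_gap (n : nat) (X : 'I_n -> T -> R) (k : nat) :
  (k <= n.+1)%N -> (forall i, measurable_fun setT (X i)) ->
  measurable_fun setT (fun w => ordered_gap (fun i => X i w) k).
Proof.
move=> kn mX; rewrite /ordered_gap; case: eqP => [_|/eqP k0]; first exact: measurable_cst.
have mb j : (j <= n.+1)%N ->
    measurable_fun setT (fun w => bordered_order_stat (fun i => X i w) j).
  move=> jn; rewrite /bordered_order_stat.
  case: eqP => [_|/eqP j0]; first exact: measurable_cst.
  case: eqP => [_|/eqP jn1]; first exact: measurable_cst.
  by apply: measurable_order_stat => //; lia.
apply: (@measurable_order_stat n.+1 (fun j w => gap (fun i => X i w) j.+1)).
  by rewrite lt0n k0.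
move=> i; apply: measurable_funB; apply: mb => //=.
by rewrite ltnW.
Qed.
End Measurability.

(** * Approximating expectations by grid cells *)

Section Approximation.
Local Open Scope classical_set_scope.
Context (R : realType) (d : measure_display) (T : measurableType d)
  (P : probability T R).

Lemma bounded_integrable (f : T -> R) (b : R) :
  measurable_fun setT f -> (forall w, `|f w| <= b) ->
  P.-integrable setT (EFin \o f).
Proof.
move=> mf fb; apply: measurable_bounded_integrable => //.
  by rewrite (le_lt_trans (probability_le1 P _)) ?ltry.
exists b; split; first exact: num_real.
by move=> c bc w _ /=; rewrite (le_trans (fb w)) ?ltW.
Qed.

Lemma Rintegral_step (I : Type) (r : seq I) (c : I -> R) (E : I -> set T) :
  (forall i, measurable (E i)) ->
  P.-integrable setT (EFin \o (fun w => \sum_(i <- r) c i * \1_(E i) w)) /\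
  \int[P]_w (\sum_(i <- r) c i * \1_(E i) w) = \sum_(i <- r) c i * fine (P (E i)).
Proof.
move=> mE; have iE i : P.-integrable setT (EFin \o (fun w => c i * \1_(E i) w)).
  apply: (@bounded_integrable _ `|c i|).
    by apply: measurable_funM => //; exact: measurable_indic.
  by move=> w; rewrite normrM ler_piMr// indicE normr_nat lern1 leq_b1.
elim: r => [|i r [IH1 IH2]].
  split; last by under eq_Rintegral do rewrite big_nil; rewrite big_nil Rintegral_cst// mul0r.
  apply: (@bounded_integrable _ 0) => [|w]; last by rewrite big_nil normr0.
  by under eq_fun do rewrite big_nil; exact: measurable_cst.
have sumE : (fun w => \sum_(j <- i :: r) c j * \1_(E j) w) =
    (fun w => c i * \1_(E i) w + \sum_(j <- r) c j * \1_(E j) w).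
  by apply/funext => w; rewrite big_cons.
rewrite sumE; split.
  have := integrableD measurableT (iE i) IH1.
  by apply: eq_integrable => //.
rewrite RintegralD// IH2 big_cons; congr (_ + _).
rewrite RintegralZl//; last first.
  apply: (@bounded_integrable _ 1) => [|w]; first exact: measurable_indic.
  by rewrite indicE normr_nat lern1 leq_b1.
by rewrite /Rintegral integral_indic// setIT.
Qed.

(** The comparison function is [sum_i c i * \1_(E i)].  The pointwise error is
    at most [e + (1 - sum_i \1_(E i))]: on [E i] this is the approximation
    hypothesis, and off all these events the bound is at least [1].
    The expectation of the bound only involves the probabilities [P (E i)]. *)
Lemma expectation_step_approx (X : T -> R) (A : set T) (I : finType)
    (D : pred I) (E : I -> set T) (c : I -> R) (e p : R) :
  measurable_fun setT X -> measurable A -> P A = 1%E ->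
  (forall w, A w -> `|X w| <= 1) ->
  (forall i, measurable (E i)) ->
  (forall i, D i -> E i `<=` A) ->
  (forall i, D i -> P (E i) = p%:E) ->
  (forall i j w, D i -> D j -> E i w -> E j w -> i = j) ->
  0 <= e -> (forall i w, D i -> E i w -> `|X w - c i| <= e) ->
  'E_P[X]%E \is a fin_num /\
  `|fine 'E_P[X]%E - \sum_(i | D i) c i * p| <= e + (1 - #|D|%:R * p).
Proof.
move=> mX mA PA XA mE EA PE E1 e0 Xc.
(* Off the almost sure event [A], nothing bounds [X]. *)
pose X' w := X w * \1_A w.
have mX' : measurable_fun setT X'.
  by apply: measurable_funM => //; exact: measurable_indic.
have iX' : P.-integrable setT (EFin \o X').
  apply: (@bounded_integrable _ 1) => // w; rewrite /X' indicE.
  have [/set_mem Aw|_] := boolP (w \in A); first by rewrite mulr1 XA.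
  by rewrite mulr0 normr0.
have EX : 'E_P[X]%E = (\int[P]_w (X' w)%:E)%E.
  rewrite unlock; apply: ae_eq_integral => //;
    [exact/measurable_EFinP|exact/measurable_EFinP|].
  exists (~` A); split; first exact: measurableC.
    by have := probability_setC P mA; rewrite PA subee.
  move=> w /= h Aw; apply: h => _ /=; congr (_%:E).
  by rewrite /X' indicE mem_set// mulr1.
have fX : 'E_P[X]%E \is a fin_num by rewrite EX; exact: integrable_fin_num.
split => //.
have -> : fine 'E_P[X]%E = \int[P]_w X' w by rewrite EX.
pose r := [seq i <- index_enum I | D i].
pose Y w := \sum_(i <- r) c i * \1_(E i) w.
pose S w := \sum_(i <- r) 1 * \1_(E i) w : R.
have [iY intY] := Rintegral_step r c mE.
have [iS intS] := Rintegral_step r (fun=> 1) mE.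
have sumP (z : I -> R) : \sum_(i <- r) z i * fine (P (E i)) = \sum_(i | D i) z i * p.
  by rewrite big_filter; apply: eq_bigr => i Di; rewrite PE.
rewrite sumP in intY; rewrite sumP in intS.
have sum1 : \sum_(i | D i) 1 * p = #|D|%:R * p.
  by rewrite sumr_const mul1r mulr_natl.
rewrite sum1 in intS.
rewrite -intY -RintegralB//.
have iXY : P.-integrable setT (EFin \o (fun w => X' w - Y w)).
  have := integrableB measurableT iX' iY.
  by apply: eq_integrable => //.
have i1 z : P.-integrable setT (EFin \o (fun=> z)) by exact: finite_measure_integrable_cst.
have iS1 : P.-integrable setT (EFin \o (fun w => 1 - S w)).
  have := integrableB measurableT (i1 1) iS.
  by apply: eq_integrable => //.
have ieS : P.-integrable setT (EFin \o (fun w => e + (1 - S w))).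
  have := integrableD measurableT (i1 e) iS1.
  by apply: eq_integrable => //.
apply: le_trans (le_normr_Rintegral measurableT iXY) _.
have -> : e + (1 - #|D|%:R * p) = \int[P]_w (e + (1 - S w)).
  have PT : fine (P setT) = 1 by rewrite probability_setT.
  by rewrite RintegralD// RintegralB// intS !Rintegral_cst// PT !mulr1.
apply: le_Rintegral => //.
  by have := integrable_norm iXY; apply: eq_integrable.
move=> w _.
have [[i Di Ei]|noE] := pselect (exists2 i, D i & E i w).
  have sumE (z : I -> R) : \sum_(j <- r) z j * \1_(E j) w = z i.
    rewrite big_filter (bigD1 i)//= indicE mem_set// mulr1 big1 ?addr0// => j /andP[Dj ji].
    rewrite indicE memNset ?mulr0// => Ej.
    by move/eqP: ji; apply; exact: E1 Dj Di Ej Ei.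
  rewrite /Y /S !sumE subrr addr0 /X' indicE mem_set ?mulr1; last exact: EA Di _ Ei.
  exact: Xc.
have sumE (z : I -> R) : \sum_(j <- r) z j * \1_(E j) w = 0.
  rewrite big_filter big1// => j Dj; rewrite indicE memNset ?mulr0// => Ej.
  by apply: noE; exists j.
rewrite /Y /S !sumE !subr0 /X' indicE.
have [/set_mem Aw|_] := boolP (w \in A).
  by rewrite mulr1 (le_trans (XA _ Aw))// lerDr.
by rewrite mulr0 normr0 addr_ge0.
Qed.

Lemma uniform_prob_itv (a b : R) : 0 <= a -> a < b -> b <= 1 ->
  uniform_prob (@ltr01 R) `[a, b[ = (b - a)%:E.
Proof.
move=> a0 ab b1; rewrite /uniform_prob (eq_integral (fun=> 1%:E)); last first.
  move=> x /set_mem; rewrite /= in_itv /= /uniform_pdf => /andP[ax xb].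
  by rewrite (le_trans a0 ax) (le_trans (ltW xb) b1) subr0 invr1.
by rewrite integral_cst//= mul1e lebesgue_measure_itv /= lte_fin ab.
Qed.
End Approximation.

Section Cells.
Local Open Scope classical_set_scope.
Context (R : realType) (d : measure_display) (T : measurableType d)
  (P : probability T R) (n : nat) (U : 'I_n -> {RV P >-> R}).
Hypothesis hindep : mutually_independent U.
Hypothesis hunif : forall i : 'I_n, uniform01 (U i).

(** The intersection is over a [{set 'I_n}] to match the definition of mutual
    independence. *)
Definition grid_cell (N : nat) (a : 'I_n -> nat) : set T :=
  \bigcap_(i in [set` [set: 'I_n]%SET])
    (U i @^-1` `[(a i)%:R / N%:R, (a i).+1%:R / N%:R[).

Lemma grid_cellP (N : nat) (a : 'I_n -> nat) (w : T) : grid_cell N a w <->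
  forall i, (a i)%:R / N%:R <= U i w < (a i).+1%:R / N%:R.
Proof.
split=> [h i|h i _] /=; last by rewrite in_itv /=; exact: h.
by have := h i; rewrite /= in_itv; apply; exact: finset.in_setT.
Qed.

Lemma measurable_grid_cell (N : nat) (a : 'I_n -> nat) : measurable (grid_cell N a).
Proof.
apply: fin_bigcap_measurable => [|i _]; first exact: finite_finset.
by rewrite -[X in measurable X]setTI; exact: measurable_funPT.
Qed.

Lemma probability_grid_cell (N : nat) (a : 'I_n -> nat) :
  (forall i, (a i < N)%N) -> P (grid_cell N a) = (N%:R ^- n)%:E.
Proof.
move=> aN.
rewrite /grid_cell hindep//.
rewrite (eq_bigr (fun=> (N%:R^-1)%:E)).
  by rewrite prodEFin prodr_const cardsT card_ord exprVn.
move=> i _.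
have N0 : 0 < N%:R :> R by rewrite ltr0n; exact: leq_ltn_trans (aN i).
have := @hunif i `[(a i)%:R / N%:R, (a i).+1%:R / N%:R[ (measurable_itv _).
rewrite uniform_prob_itv.
- by rewrite -mulrBl -natrB// subSnn mul1r.
- by rewrite divr_ge0.
- by rewrite ltr_pM2r ?invr_gt0// ltr_nat.
- by rewrite ler_pdivrMr// mul1r ler_nat.
Qed.

Lemma grid_cell_unique (N : nat) (a b : 'I_n -> nat) (w : T) : (0 < N)%N ->
  grid_cell N a w -> grid_cell N b w -> a =1 b.
Proof.
move=> N0 /grid_cellP ha /grid_cellP hb i.
have N0' : 0 < N%:R^-1 :> R by rewrite invr_gt0 ltr0n.
have /andP[a1 a2] := ha i; have /andP[b1 b2] := hb i.
have := le_lt_trans a1 b2; rewrite ltr_pM2r// ltr_nat.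
have := le_lt_trans b1 a2; rewrite ltr_pM2r// ltr_nat.
lia.
Qed.

Definition unit_cube : set T := \bigcap_(i in [set` [set: 'I_n]%SET]) (U i @^-1` `[0, 1[).

Lemma probability_unit_cube : P unit_cube = 1%E.
Proof.
have -> : unit_cube = grid_cell 1 (fun=> 0%N).
  by rewrite /grid_cell mul0r divr1.
by rewrite probability_grid_cell// expr1n invr1.
Qed.
End Cells.

(** * The limit of the lattice averages *)

Lemma cvg_sumr (R : realType) (I : eqType) (r : seq I) (f : I -> nat -> R) (l : I -> R) :
  (forall i, i \in r -> (f i M @[M --> \oo] --> l i)%classic) ->
  ((\sum_(i <- r) f i M : R) @[M --> \oo] --> (\sum_(i <- r) l i : R))%classic.
Proof.
elim: r => [|i r IH] fl.
  by under eq_fun do rewrite big_nil; rewrite big_nil; exact: cvg_cst.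
under eq_fun do rewrite big_cons; rewrite big_cons; apply: cvgD.
  by apply: fl; rewrite mem_head.
by apply: IH => j jr; apply: fl; rewrite in_cons jr orbT.
Qed.

Section OrderedGapExpectation.
Local Open Scope classical_set_scope.
Context (R : realType) (d : measure_display) (T : measurableType d)
  (P : probability T R) (n : nat) (U : 'I_n -> {RV P >-> R}).
Hypothesis n0 : (0 < n)%N.
Hypothesis hindep : mutually_independent U.
Hypothesis hunif : forall i : 'I_n, uniform01 (U i).

Lemma occupied_cell_ltn (M : nat) (g : n.+1.-tuple 'I_M.+1) (i : 'I_n) :
  g \in weak_compositions n.+1 M -> (occupied_cell g i < M + n)%N.
Proof. by move=> gM; rewrite -(occupied_cell_last gM); exact: occupied_cell_mono. Qed.

(** The points are within [1 / N] of the left ends of their cells, which costs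
    [2 / N] on the gaps; replacing the gaps of these left ends by the parts of
    [g] costs another [1 / N]. *)
Lemma ordered_gap_grid_cell (M k : nat) (g : n.+1.-tuple 'I_M.+1) (s : {perm 'I_n}) (w : T) :
  (k <= n.+1)%N -> g \in weak_compositions n.+1 M ->
  grid_cell U (M + n) (fun i => occupied_cell g (s i)) w ->
  `|ordered_gap (fun i => U i w) k - (ordered_part g k)%:R / (M + n)%:R|
  <= 3 / (M + n)%:R.
Proof.
move=> kn gM /grid_cellP cw.
have N0 : 0 <= (M + n)%:R^-1 :> R by rewrite invr_ge0.
have h1 := @ordered_gap_lattice_point R n M g s k n0 kn gM.
have h2 : `|ordered_gap (fun i => U i w) k - ordered_gap (lattice_point R g s) k|
    <= 2 * (M + n)%:R^-1.
  apply: ordered_gap_lipschitz => // i.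
  have /andP[c1 c2] := cw i; rewrite /lattice_point ler_distl.
  rewrite (le_trans _ c1) ?gerBl//=.
  by rewrite (le_trans (ltW c2))// -addn1 natrD mulrDl mul1r.
rewrite -(subrKA (ordered_gap (lattice_point R g s) k)).
apply: le_trans (ler_normD _ _) _; apply: le_trans (lerD h2 h1) _.
by rewrite le_eqVlt; apply/orP; left; apply/eqP; ring.
Qed.

(** The grid cell determines the multiset of occupied intervals, hence the
    sorted configuration and the composition; the points of a composition
    being distinct, it then determines the permutation. *)
Lemma grid_cell_composition_unique (M : nat) (g g' : n.+1.-tuple 'I_M.+1)
    (s s' : {perm 'I_n}) (w : T) :
  g \in weak_compositions n.+1 M -> g' \in weak_compositions n.+1 M ->
  grid_cell U (M + n) (fun i => occupied_cell g (s i)) w ->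
  grid_cell U (M + n) (fun i => occupied_cell g' (s' i)) w ->
  (g, s) = (g', s').
Proof.
move=> gM gM' cw cw'.
have Nn : (0 < M + n)%N by lia.
have e := grid_cell_unique Nn cw cw'.
have N0 : (M + n)%:R^-1 != 0 :> R by rewrite invr_eq0 pnatr_eq0; lia.
have gg' : g = g'.
  apply: occupied_cell_inj => // i.
  have := @order_stat_lattice_point R n.+1 M n g s i.
  rewrite (@order_stat_ext R n _ (lattice_point R g' s')); last first.
    by move=> j; rewrite /lattice_point; have /= -> := e j.
  rewrite order_stat_lattice_point => /(mulIf N0)/eqP.
  by rewrite eqr_nat => /eqP ->.
congr (_, _) => //; apply/permP => i; apply: val_inj => /=.
have /= := e i; rewrite -gg'.
by case: (ltngtP (s i) (s' i)) => // /occupied_cell_mono => /(_ _ _ g) + ee; rewrite ee ltnn.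
Qed.

(** The grid cells indexed by weak compositions and permutations number
    'C(M + n, n) * n! = (M + n) ^_ n, which gives the proportion of the cube
    that is not covered. *)
Lemma expectation_ordered_gap_approx (M k : nat) : (k <= n.+1)%N ->
  'E_P[fun w => ordered_gap (fun i => U i w) k]%E \is a fin_num /\
  `|fine 'E_P[fun w => ordered_gap (fun i => U i w) k]%E
    - n`!%:R / (M + n)%:R ^+ n.+1 * (total_ordered_part n M k)%:R|
  <= 3 / (M + n)%:R + (1 - ((M + n) ^_ n)%:R / (M + n)%:R ^+ n).
Proof.
move=> kn.
pose I : finType := (n.+1.-tuple 'I_M.+1 * {perm 'I_n})%type.
pose D : pred I := [pred gs | gs.1 \in weak_compositions n.+1 M].
pose E (gs : I) := grid_cell U (M + n) (fun i => occupied_cell gs.1 (gs.2 i)).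
pose c (gs : I) : R := (ordered_part gs.1 k)%:R / (M + n)%:R.
have N0 : 0 < (M + n)%:R :> R by rewrite ltr0n; lia.
have cardD : #|D| = (M + n) ^_ n.
  transitivity #|finset.setX (weak_compositions n.+1 M) [set: {perm 'I_n}]%SET|.
    by apply: eq_card => -[g s]; rewrite !inE andbT.
  by rewrite cardsX cardsT card_weak_compositions card_Sn bin_ffact.
have sumc : \sum_(gs | D gs) c gs * (M + n)%:R ^- n =
    n`!%:R / (M + n)%:R ^+ n.+1 * (total_ordered_part n M k)%:R.
  transitivity (\sum_(g in weak_compositions n.+1 M) \sum_(s : {perm 'I_n})
      c (g, s) * (M + n)%:R ^- n).
    by rewrite pair_big_dep /=; apply: eq_big => [[g s]|[g s] _] //=; rewrite andbT.
  rewrite natr_sum mulr_sumr; apply: eq_bigr => g _.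
  rewrite /c /= sumr_const card_Sn -mulr_natl exprS.
  move: ((M + n)%:R : R) N0 => N N0.
  by field; rewrite expf_neq0 lt0r_neq0.
have := @expectation_step_approx R d T P (fun w => ordered_gap (fun i => U i w) k)
  (unit_cube U) I D E c (3 / (M + n)%:R) ((M + n)%:R ^- n).
rewrite cardD sumc; apply.
- by apply: measurable_ordered_gap.
- apply: fin_bigcap_measurable => [|i _]; first exact: finite_finset.
  by rewrite -[X in measurable X]setTI; exact: measurable_funPT.
- exact: probability_unit_cube.
- move=> w cw; apply: normr_ordered_gap_le1 => // i.
  have := cw i; rewrite /= in_itv /= => /(_ (finset.in_setT i)) /andP[-> /ltW].
  by [].
- by move=> gs; exact: measurable_grid_cell.
- move=> [g s] gM w /grid_cellP cw i _ /=; rewrite in_itv /=.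
  have /andP[c1 c2] := cw i; rewrite (le_trans _ c1) ?divr_ge0//= (lt_le_trans c2)//.
  by rewrite ler_pdivrMr// mul1r ler_nat; exact: occupied_cell_ltn.
- move=> [g s] gM; apply: probability_grid_cell => //= i.
  exact: occupied_cell_ltn.
- by move=> [g s] [g' s'] w; exact: grid_cell_composition_unique.
- by rewrite divr_ge0.
- by move=> [g s] w gM; exact: ordered_gap_grid_cell.
Qed.

(** The normalization is 1 / N, the length of a cell, times the common
    probability [N ^- n] of the grid cells, times the [n!] orders of the points. *)
Lemma cvg_total_ordered_part (k : nat) : (k <= n.+1)%N ->
  (n`!%:R / (M + n)%:R ^+ n.+1 * (total_ordered_part n M k)%:R : R) @[M --> \oo]
  --> fine 'E_P[fun w => ordered_gap (fun i => U i w) k]%E.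
Proof.
move=> kn.
have ce : (3 / (M + n)%:R + (1 - ((M + n) ^_ n)%:R / (M + n)%:R ^+ n) : R) @[M --> \oo]
    --> (0 : R).
  rewrite -[X in _ --> X](_ : 3 * 0 + (1 - 1) = 0 :> R); last by rewrite mulr0 subrr addr0.
  apply: cvgD; first by apply: cvgMr; exact: cvg_inv_shift.
  by apply: cvgB; [exact: cvg_cst | exact: cvg_ffact_ratio].
set x := fine _.
have cl : (x - (3 / (M + n)%:R + (1 - ((M + n) ^_ n)%:R / (M + n)%:R ^+ n)) : R) @[M --> \oo]
    --> x.
  by rewrite -[X in _ --> X]subr0; apply: cvgB => //; exact: cvg_cst.
have cu : (x + (3 / (M + n)%:R + (1 - ((M + n) ^_ n)%:R / (M + n)%:R ^+ n)) : R) @[M --> \oo]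
    --> x.
  by rewrite -[X in _ --> X]addr0; apply: cvgD => //; exact: cvg_cst.
apply: (squeeze_cvgr _ cl cu); near=> M.
by have [_] := expectation_ordered_gap_approx M kn; rewrite ler_distlC.
Unshelve. all: by end_near. Qed.

End OrderedGapExpectation.

Unset Implicit Arguments.

Theorem corollary1p4 (R : realType) (d : measure_display)
    (T : measurableType d) (P : probability T R)
    (n : nat) (hn : (1 <= n)%N)
    (U : 'I_n -> {RV P >-> R})
    (hindep : mutually_independent U)
    (hunif : forall i : 'I_n, uniform01 (U i))
    (k : nat) (hk : (k <= n.+1)%N) :
  ('E_P[fun w : T => ordered_gap (fun i : 'I_n => U i w) k] =
   ((harmonic_number R n.+1 - harmonic_number R (n.+1 - k)) / n.+1%:R)%:E)%E.
Proof.
pose x k := fine 'E_P[fun w : T => ordered_gap (fun i : 'I_n => U i w) k]%E.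
have [fE _] := expectation_ordered_gap_approx hn hindep hunif 0 hk.
rewrite -[LHS]fineK//; congr (_%:E); rewrite -/(x k).
apply: harmonic_telescope => //.
  rewrite /x (_ : (fun w => _) = cst 0); first by rewrite expectation_cst.
  by apply/funext.
apply: (@bin_triangular_unique R n.+1 (fun j => x (n.+1 - j).+1 - x (n.+1 - j)%N)
   (fun j => (n.+1 * j)%:R^-1)) => s /andP[s0 sn].
(* Both sides are limits of the normalized identity [total_ordered_part_bin]. *)
rewrite sum_bin_inv//.
pose z M : R := n`!%:R / (M + n)%:R ^+ n.+1.
have c1 : ((z M * ('C(n.+1, s) * shifted_bin_sum n s M)%:R : R) @[M --> \oo]
    --> ('C(n.+1, s)%:R / (s * n.+1)%:R : R))%classic.
  under eq_fun do rewrite natrM mulrCA.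
  by apply: cvgMr; exact: cvg_shifted_bin_sum.
have c2 : ((z M * ('C(n.+1, s) * shifted_bin_sum n s M)%:R : R) @[M --> \oo]
    --> (\sum_(1 <= j < n.+2) 'C(j, s)%:R * (x (n.+1 - j).+1 - x (n.+1 - j)%N) : R))%classic.
  under eq_fun do rewrite -total_ordered_part_bin// mulr_sumr.
  apply: cvg_sumr => j; rewrite mem_index_iota => /andP[j0 jn].
  under eq_fun do rewrite mulrCA mulrBr.
  apply: cvgMr; apply: cvgB; apply: cvg_total_ordered_part => //; lia.
exact: cvg_unique c2 c1.
Qed.
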